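(* Let $\mathcal{G}$ be an ultragraph that satisfies Condition (RFUM2), and let $G(X,\sigma)$ and $\mathcal{G}_T$ be the groupoid associated to $\mathcal{G}$ and the transformation groupoid associated with $\mathcal{G}$, respectively. Then the map $$\Psi:\mathcal{G}_T\rightarrow G(X,\sigma),\qquad (x,ab^{-1},y)\mapsto(x,|a|-|b|,y),$$ where $ab^{-1}$ is in reduced form, $x=ax'$, $y=bx'$ and $x=\theta_{ab^{-1}}(y)$, is an isomorphism of topological groupoids (i.e. a groupoid isomorphism that is a homeomorphism).
   Context: An ultragraph $\mathcal{G}=(G^0,\mathcal{G}^1,r,s)$ consists of countable sets $G^0$ (vertices) and $\mathcal{G}^1$ (edges) and maps $s:\mathcal{G}^1\to G^0$, $r:\mathcal{G}^1\to P(G^0)\setminus\{\emptyset\}$. $\mathcal{G}^0$ (generalized vertices) is the smallest subset of $P(G^0)$ containing $\{v\}$ for all $v\in G^0$ and $r(e)$ for all $e\in\mathcal{G}^1$, and closed under finite unions and nonempty finite intersections. For $A\in\mathcal{G}^0$, $\varepsilon(A)=\{e\in\mathcal{G}^1:s(e)\in A\}$; $A$ is an infinite emitter if $|\varepsilon(A)|=\infty$ and a finite emitter otherwise. A vertex $v$ is a sink if $s^{-1}(v)=\emptyset$ and regular if $0<|s^{-1}(v)|<\infty$; $G^0_s$ is the set of sinks. $A\in\mathcal{G}^0$ is a minimal infinite emitter if it is an infinite emitter and no proper subset $B\in\mathcal{G}^0$ of $A$ is an infinite emitter or a finite emitter with $|B|=\infty$. $A\in\mathcal{G}^0$ is a minimal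 sink if $|A|=\infty$, $|\varepsilon(A)|<\infty$ and no proper subset $B\in\mathcal{G}^0$ of $A$ is infinite. Condition (RFUM2): for each $e\in\mathcal{G}^1$, $r(e)=\bigcup_{n=1}^kA_n$ for finitely many $A_n$, each of which is a minimal infinite emitter, or a minimal sink, or a singleton formed by a sink or a regular vertex. A finite path of length $n\ge1$ is $\alpha=e_1\ldots e_n$ with $e_i\in\mathcal{G}^1$, $s(e_{i+1})\in r(e_i)$; $s(\alpha)=s(e_1)$, $r(\alpha)=r(e_n)$. An ultrapath of length $n\ge 1$ is a pair $(\alpha,A)$ with $\alpha$ a finite path of length $n$, $A\in\mathcal{G}^0$, $A\subseteq r(\alpha)$; an ultrapath of length $0$ is an $A\in\mathcal{G}^0$, also written $(A,A)$, with $s(A)=r(A)=A$. $\mathfrak{p}$ is the set of all ultrapaths; $\mathfrak{p}^\infty$ the set of infinite paths $e_1e_2\ldots$ with $s(e_{i+1})\in r(e_i)$. $X_{fin}$ is the set of ultrapaths $(\alpha,A)$ of length $\geq 0$ (meaning $(A,A)$ for length $0$) such that $A$ is a minimal infinite emitter, or a minimal sink, or $A=\{v\}$ with $v$ a sink; $X_{sin}\subseteq X_{fin}$ consists of those for which $A$ is a minimal sink or $A=\{v\}$, $v$ a sink. $X=\mathfrak{p}^\infty\sqcup X_{fin}$. Topology on $X$: the basis consists of $D_{(\beta,B)}=\{y\in X: y=\beta\gamma,\ s(\gamma)\in B\}$ for $(\beta,B)\in\mathfrak{p}$, $|\beta|\ge1$ (for $\gamma=(C,C)$ of length $0$, $y=(\beta,C)$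 and the condition reads $C\subseteq B$), and $D_{(\beta,B),F,S}=\{(\beta,B)\}\cup\{y\in X:y=\beta\gamma',|\gamma'|\ge1,\gamma'_1\in\varepsilon(B)\setminus F\}\cup\{(\beta,\{v\})\in X_{sin}:v\in B\setminus S\}$ for $(\beta,B)\in X_{fin}$, $F\subseteq\varepsilon(B)$, $S\subseteq B\cap G^0_s$ finite (for $|\beta|=0$: $\beta\gamma'=\gamma'$, $(\beta,\{v\})$ means $(\{v\},\{v\})$). $X$ is locally compact Hausdorff. Shift: for $n\in\mathbb{N}=\{0,1,2,\ldots\}$, $X_\infty^{\geq n}=\{x\in X:|x|\geq n\}$ (infinite paths included). $\sigma:X_\infty^{\ge1}\to X$ deletes the first edge: $\gamma_1\gamma_2\ldots\mapsto\gamma_2\gamma_3\ldots$, $(\gamma_1\ldots\gamma_n,A)\mapsto(\gamma_2\ldots\gamma_n,A)$ for $n\ge2$, $(\gamma_1,A)\mapsto(A,A)$. $\sigma^n$ is the $n$-fold composition on $X_\infty^{\ge n}$, $\sigma^0=\mathrm{id}$. $G(X,\sigma)=\{(x,m-n,y):x,y\in X,\ m,n\in\mathbb{N},\ \sigma^m(x)=\sigma^n(y)\}$ with $s(x,k,y)=y$, $r(x,k,y)=x$, $(x,k,y)(y,l,z)=(x,k+l,z)$, $(x,k,y)^{-1}=(y,-k,x)$, and topology with basic open sets $Z(U,m,n,V)=\{(x,k,y)\in G(X,\sigma):x\in U,k=m-n,y\in V,\sigma^m(x)=\sigma^n(y)\}$, where $U\subseteq X_\infty^{\ge m}$, $V\subseteq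 X_\infty^{\ge n}$ are open, $\sigma^m|_U$ and $\sigma^n|_V$ are injective and $\sigma^m(U)=\sigma^n(V)$. Partial action: $\mathbb{F}$ is the (discrete) free group generated by $\mathcal{G}^1$, with neutral element $0$; $P=\{e_1\ldots e_n\in\mathbb{F}:e_i\in\mathcal{G}^1,n\ge1\}$. Put $X_0=X$. For a finite path $a\in P$: $X_a$ is the set of $x\in X$ whose first $|a|$ edges are $a$; $X_{a^{-1}}=\{x\in X: s(x)\in r(a)\}$ (for $x=(A,A)$: $A\subseteq r(a)$). For finite paths $a,b\in P$ with $ab^{-1}$ reduced: $X_{ab^{-1}}$ is the set of $x=ax'\in X_a$ with $s(x')\in r(a)\cap r(b)$ (for $x=(a,A)$: $A\subseteq r(a)\cap r(b)$). All other $X_c$ are empty. $\theta_0=\mathrm{id}$; $\theta_a:X_{a^{-1}}\to X_a$, $x\mapsto ax$ (with $(A,A)\mapsto(a,A)$); $\theta_{a^{-1}}=\theta_a^{-1}$; $\theta_{ab^{-1}}:X_{ba^{-1}}\to X_{ab^{-1}}$, $bx\mapsto ax$ (with $(b,A)\mapsto(a,A)$). $\mathcal{G}_T=\{(x,c,y)\in X\times\mathbb{F}\times X:\ y\in X_{c^{-1}},\ x=\theta_c(y)\}$ with $s(x,c,y)=y$, $r(x,c,y)=x$, $(x,c,y)(y,d,z)=(x,cd,z)$, $(x,c,y)^{-1}=(y,c^{-1},x)$, and the topology inherited from the product topology on $X\times\mathbb{F}\times X$. Every $c$ occurring in an element of $\mathcal{G}_T$ has a reduced form $ab^{-1}$ where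 each of $a,b$ is a finite path or the empty word (of length $0$). *)

(* Defs.v *)
From HB Require Import structures.
From mathcomp Require Import all_boot all_order all_algebra.
From mathcomp Require Import all_classical all_reals all_analysis.
From mathcomp Require Import zify.

Set Implicit Arguments.
Unset Strict Implicit.
Unset Printing Implicit Defensive.

Import Order.TTheory GRing.Theory Num.Theory.

Local Open Scope classical_set_scope.

(** * Free groups *)

(** A letter [(e, true)] stands for the generator [e], and [(e, false)] for its
    inverse; an element of the free group is its reduced word. *)
Section FreeGroup.
Variable E : choiceType.

Definition letter_inv (l : E * bool) : E * bool := (l.1, ~~ l.2).

Definition reduced (w : seq (E * bool)) : bool :=
  sorted (fun l l' => l' != letter_inv l) w.

Record free_group := FreeGroup {
  fg_word :> seq (E * bool);
  fg_reduced : reduced fg_word }.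

HB.instance Definition _ := [isSub for fg_word].
HB.instance Definition _ := [Choice of free_group by <:].

Definition fg_push (l : E * bool) (w : seq (E * bool)) :=
  if w is l' :: w' then if l' == letter_inv l then w' else l :: w else [:: l].

Lemma letter_invK : involutive letter_inv.
Proof. by case=> e b; rewrite /letter_inv negbK. Qed.

Lemma fg_push_reduced l w : reduced w -> reduced (fg_push l w).
Proof.
case: w => [//|l' w] /= rw; case: ifPn => [_|nl] /=; last by rewrite nl.
exact: path_sorted rw.
Qed.

Definition fg_cat (u v : seq (E * bool)) := foldr fg_push v u.

Lemma fg_cat_reduced u v : reduced v -> reduced (fg_cat u v).
Proof. by move=> rv; elim: u => //= l u /(fg_push_reduced l). Qed.

Lemma fg_pushK l w : reduced w -> fg_push l (fg_push (letter_inv l) w) = w.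
Proof.
case: w => [_|l' w] /=; first by rewrite eqxx.
rewrite letter_invK; case: ifPn => [/eqP ->|_ _] /=; last by rewrite eqxx.
by case: w => [//|l'' w] /= /andP[/negPf ->].
Qed.

Lemma fg_cat_push l u w : reduced w ->
  fg_cat (fg_push l u) w = fg_push l (fg_cat u w).
Proof.
move=> rw; case: u => [//|l' u] /=; case: ifPn => [/eqP ->|//].
by rewrite fg_pushK//; apply: fg_cat_reduced.
Qed.

Lemma fg_cat_word u v : reduced (u ++ v) -> fg_cat u v = u ++ v.
Proof.
elim: u => [//|l u IH] /= ruv; rewrite IH; last exact: path_sorted ruv.
by case: (u ++ v) ruv => [//|l' w] /= /andP[/negPf ->].
Qed.

Definition fg_inv_word (w : seq (E * bool)) := rev (map letter_inv w).

Lemma fg_inv_reduced w : reduced w -> reduced (fg_inv_word w).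
Proof.
rewrite /reduced /fg_inv_word rev_sorted sorted_map; apply: sub_sorted => l l'.
by rewrite /= letter_invK eq_sym.
Qed.

Lemma fg_inv_wordK : involutive fg_inv_word.
Proof.
move=> w; rewrite /fg_inv_word map_rev revK -map_comp map_id_in// => l _ /=.
exact: letter_invK.
Qed.

Lemma fg_cat_inv w : fg_cat (fg_inv_word w) w = [::].
Proof.
rewrite /fg_inv_word.
elim: w => [//|l w IH] /=.
by rewrite rev_cons -cats1 /fg_cat foldr_cat /= letter_invK eqxx.
Qed.

Definition fg_one : free_group := @FreeGroup [::] isT.
Definition fg_mul (u v : free_group) : free_group :=
  FreeGroup (fg_cat_reduced u (fg_reduced v)).
Definition fg_inv (u : free_group) : free_group :=
  FreeGroup (fg_inv_reduced (fg_reduced u)).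

Lemma fg_mulA : associative fg_mul.
Proof.
move=> u v w; apply: val_inj => /=; elim: (fg_word u) => [//|l s IH] /=.
by rewrite fg_cat_push ?IH//; apply: fg_reduced.
Qed.

Lemma fg_mul1 : left_id fg_one fg_mul.
Proof. by move=> u; apply: val_inj. Qed.

Lemma fg_mulr1 : right_id fg_one fg_mul.
Proof.
move=> u; apply: val_inj; rewrite /= fg_cat_word ?cats0//; exact: fg_reduced.
Qed.

Lemma fg_mulV : left_inverse fg_one fg_inv fg_mul.
Proof. by move=> u; apply: val_inj; rewrite /= fg_cat_inv. Qed.

Lemma fg_mulrV : right_inverse fg_one fg_inv fg_mul.
Proof.
by move=> u; apply: val_inj; rewrite /= -{1}[fg_word u]fg_inv_wordK fg_cat_inv.
Qed.

HB.instance Definition _ := isGroup.Build free_group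
  fg_mulA fg_mul1 fg_mulr1 fg_mulV fg_mulrV.

HB.instance Definition _ := hasNbhs.Build free_group principal_filter.
HB.instance Definition _ := Discrete_ofNbhs.Build free_group erefl.

(** [c] has the reduced form [a b^-1] for the positive words [a] and [b]. *)
Definition reduced_form (c : free_group) (a b : seq E) : Prop :=
  fg_word c = [seq (e, true) | e <- a] ++ [seq (e, false) | e <- rev b].

Lemma reduced_form_inj c a b a' b' :
  reduced_form c a b -> reduced_form c a' b' -> a = a' /\ b = b'.
Proof.
rewrite /reduced_form => -> h.
have f1 (s t : seq E) : [seq l.1 | l <- [seq (e, true) | e <- s] ++
    [seq (e, false) | e <- rev t] & l.2] = s.
  rewrite filter_cat !filter_map /= filter_predT filter_pred0 cats0 -map_comp.
  exact: map_id.
have f2 (s t : seq E) : [seq l.1 | l <- [seq (e, true) | e <- s] ++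
    [seq (e, false) | e <- rev t] & ~~ l.2] = rev t.
  rewrite filter_cat !filter_map /= filter_predT filter_pred0 -map_comp.
  exact: map_id.
by split; [rewrite -(f1 a b) h f1|apply: (can_inj revK); rewrite -(f2 a b) h f2].
Qed.

Lemma reduced_form_inv c a b : reduced_form c a b -> reduced_form (c^-1)%g b a.
Proof.
rewrite /reduced_form /= => ->; rewrite /fg_inv_word map_cat rev_cat -!map_rev.
by rewrite -!map_comp !revK.
Qed.

Lemma positive_reduced (a : seq E) : reduced [seq (e, true) | e <- a].
Proof.
by case: a => //= e a; elim: a e => //= e' a IH e; rewrite IH andbT; apply/eqP => -[].
Qed.

(** The image in the free group of a positive word *)
Definition fg_positive (a : seq E) : free_group :=
  FreeGroup (positive_reduced a).

Lemma fg_positive_cat a b : fg_positive (a ++ b) = (fg_positive a * fg_positive b)%g.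
Proof.
apply: val_inj; rewrite /= map_cat fg_cat_word// -map_cat; exact: positive_reduced.
Qed.

Lemma fg_positive_inv a :
  fg_word (fg_positive a)^-1%g = [seq (e, false) | e <- rev a].
Proof. by rewrite /= /fg_inv_word -map_comp map_rev. Qed.

Lemma reduced_formE c a b :
  reduced_form c a b -> c = (fg_positive a * (fg_positive b)^-1)%g.
Proof.
rewrite /reduced_form => h; apply: val_inj.
have := fg_reduced c; rewrite h => rc.
by rewrite [RHS](_ : _ = fg_cat (fg_positive a) (fg_positive b)^-1%g)// fg_positive_inv fg_cat_word.
Qed.

Lemma reduced_formP a b :
  a = [::] \/ b = [::] \/
  (exists a' e b' f, [/\ a = rcons a' e, b = rcons b' f & e != f]) ->
  reduced_form (fg_positive a * (fg_positive b)^-1)%g a b.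
Proof.
move=> h; have := fg_reduced (fg_positive b)^-1%g; rewrite fg_positive_inv => rb.
rewrite /reduced_form [LHS](_ : _ = fg_cat (fg_positive a) (fg_positive b)^-1%g)//.
rewrite fg_positive_inv; apply: fg_cat_word; case: h => [->//|[->|]].
  by rewrite cats0; exact: positive_reduced.
move=> [a' [e [b' [f [aE bE ef]]]]]; have := positive_reduced a.
move: rb; rewrite aE bE rev_rcons map_rcons /= => rb.
rewrite /reduced; case: a' {aE} => [|e' a'] /=; rewrite ?cat_path ?last_rcons/=.
  move=> _; rewrite rb andbT; apply/eqP => -[fe]; by rewrite fe eqxx in ef.
rewrite map_rcons last_rcons => ->/=; rewrite rb andbT; apply/eqP => -[fe]; by rewrite fe eqxx in ef.
Qed.

End FreeGroup.

(** * Groupoids *)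

(** [gmul g h] is the product of [g] and [h] when [gsrc g = grng h], and is
    irrelevant otherwise. *)
Record groupoid (O T : Type) := Groupoid {
  gsrc : T -> O;
  grng : T -> O;
  gid : O -> T;
  gmul : T -> T -> T;
  ginv : T -> T;
  gsrc_id : forall x, gsrc (gid x) = x;
  grng_id : forall x, grng (gid x) = x;
  gsrc_mul : forall g h, gsrc g = grng h -> gsrc (gmul g h) = gsrc h;
  grng_mul : forall g h, gsrc g = grng h -> grng (gmul g h) = grng g;
  gmulA : forall g h k, gsrc g = grng h -> gsrc h = grng k ->
    gmul g (gmul h k) = gmul (gmul g h) k;
  gmul1 : forall g, gmul (gid (grng g)) g = g;
  gmulr1 : forall g, gmul g (gid (gsrc g)) = g;
  gsrc_inv : forall g, gsrc (ginv g) = grng g;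
  grng_inv : forall g, grng (ginv g) = gsrc g;
  gmulV : forall g, gmul (ginv g) g = gid (gsrc g);
  gmulrV : forall g, gmul g (ginv g) = gid (grng g) }.

Definition composable (O T : Type) (G : groupoid O T) (g h : T) : Prop :=
  gsrc G g = grng G h.

Definition groupoid_isomorphism (O1 O2 T1 T2 : Type)
    (G1 : groupoid O1 T1) (G2 : groupoid O2 T2) (f : T1 -> T2) : Prop :=
  [/\ bijective f,
      forall g h, composable G1 g h <-> composable G2 (f g) (f h) &
      forall g h, composable G1 g h ->
        f (gmul G1 g h) = gmul G2 (f g) (f h)].

Definition homeomorphism (T1 T2 : topologicalType) (f : T1 -> T2) : Prop :=
  [/\ bijective f, continuous f & forall U : set T1, open U -> open (f @` U)].

Definition topological_groupoid_isomorphism (O1 O2 : Type)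
    (T1 T2 : topologicalType) (G1 : groupoid O1 T1) (G2 : groupoid O2 T2)
    (f : T1 -> T2) : Prop :=
  groupoid_isomorphism G1 G2 f /\ homeomorphism f.

(** The groupoid of the triples [(x, k, y)] in [S], where [k] lies in a group,
    with [s(x, k, y) = y], [r(x, k, y) = x], [(x, k, y)(y, l, z) = (x, kl, z)]
    and [(x, k, y)^-1 = (y, k^-1, x)]. *)
Section TripleGroupoid.
Variables (O K : Type) (op : K -> K -> K) (one : K) (inv : K -> K).
Hypotheses (opA : associative op) (op1 : left_id one op)
  (opr1 : right_id one op) (opV : left_inverse one inv op)
  (oprV : right_inverse one inv op).
Variables (S : set (O * K * O)) (T : subType (fun g => g \in S)).
Hypotheses (S_id : forall x, S (x, one, x))
  (S_mul : forall x k y l z, S (x, k, y) -> S (y, l, z) -> S (x, op k l, z))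
  (S_inv : forall x k y, S (x, k, y) -> S (y, inv k, x)).

Definition triple_rng (g : T) : O := (val g).1.1.
Definition triple_lab (g : T) : K := (val g).1.2.
Definition triple_src (g : T) : O := (val g).2.

Definition triple_id (x : O) : T := Sub (x, one, x) (mem_set (S_id x)).
Definition triple_mul (g h : T) : T :=
  insubd g (triple_rng g, op (triple_lab g) (triple_lab h), triple_src h).
Definition triple_inv (g : T) : T :=
  insubd g (triple_src g, inv (triple_lab g), triple_rng g).

Lemma tripleP (g : T) : S (triple_rng g, triple_lab g, triple_src g).
Proof.
by rewrite /triple_rng /triple_lab /triple_src -!surjective_pairing; apply/set_mem/(valP g).
Qed.

Lemma val_triple_id x : val (triple_id x) = (x, one, x).
Proof. exact: SubK. Qed.

Lemma val_triple_mul g h : triple_src g = triple_rng h ->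
  val (triple_mul g h) =
  (triple_rng g, op (triple_lab g) (triple_lab h), triple_src h).
Proof.
move=> gh; rewrite val_insubd mem_set//; apply: S_mul (tripleP g) _.
by rewrite gh; exact: tripleP.
Qed.

Lemma val_triple_inv g :
  val (triple_inv g) = (triple_src g, inv (triple_lab g), triple_rng g).
Proof. by rewrite val_insubd mem_set//; apply/S_inv/tripleP. Qed.

Lemma triple_eq g h : triple_rng g = triple_rng h ->
  triple_lab g = triple_lab h -> triple_src g = triple_src h -> g = h.
Proof.
rewrite /triple_rng /triple_lab /triple_src => e1 e2 e3; apply: val_inj.
by move: (val g) (val h) e1 e2 e3 => [[? ?] ?] [[? ?] ?] /= -> -> ->.
Qed.

Lemma triple_src_id x : triple_src (triple_id x) = x.
Proof. by rewrite /triple_src val_triple_id. Qed.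

Lemma triple_rng_id x : triple_rng (triple_id x) = x.
Proof. by rewrite /triple_rng val_triple_id. Qed.

Lemma triple_lab_id x : triple_lab (triple_id x) = one.
Proof. by rewrite /triple_lab val_triple_id. Qed.

Lemma triple_src_mul g h : triple_src g = triple_rng h ->
  triple_src (triple_mul g h) = triple_src h.
Proof. by move=> gh; rewrite {1}/triple_src val_triple_mul. Qed.

Lemma triple_rng_mul g h : triple_src g = triple_rng h ->
  triple_rng (triple_mul g h) = triple_rng g.
Proof. by move=> gh; rewrite {1}/triple_rng val_triple_mul. Qed.

Lemma triple_lab_mul g h : triple_src g = triple_rng h ->
  triple_lab (triple_mul g h) = op (triple_lab g) (triple_lab h).
Proof. by move=> gh; rewrite {1}/triple_lab val_triple_mul. Qed.

Lemma triple_src_inv g : triple_src (triple_inv g) = triple_rng g.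
Proof. by rewrite {1}/triple_src val_triple_inv. Qed.

Lemma triple_rng_inv g : triple_rng (triple_inv g) = triple_src g.
Proof. by rewrite {1}/triple_rng val_triple_inv. Qed.

Lemma triple_lab_inv g : triple_lab (triple_inv g) = inv (triple_lab g).
Proof. by rewrite {1}/triple_lab val_triple_inv. Qed.

Lemma triple_mulA g h k : triple_src g = triple_rng h ->
  triple_src h = triple_rng k ->
  triple_mul g (triple_mul h k) = triple_mul (triple_mul g h) k.
Proof.
move=> gh hk; have ghk : triple_src g = triple_rng (triple_mul h k).
  by rewrite triple_rng_mul.
have ghk' : triple_src (triple_mul g h) = triple_rng k.
  by rewrite triple_src_mul.
by apply: triple_eq; rewrite ?(triple_rng_mul, triple_src_mul, triple_lab_mul).
Qed.

Lemma triple_mul1 g : triple_mul (triple_id (triple_rng g)) g = g.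
Proof.
have e := triple_src_id (triple_rng g).
by apply: triple_eq; rewrite ?(triple_rng_mul, triple_src_mul, triple_lab_mul)//
  ?(triple_rng_id, triple_lab_id).
Qed.

Lemma triple_mulr1 g : triple_mul g (triple_id (triple_src g)) = g.
Proof.
have e := esym (triple_rng_id (triple_src g)).
by apply: triple_eq; rewrite ?(triple_rng_mul, triple_src_mul, triple_lab_mul)//
  ?(triple_src_id, triple_lab_id).
Qed.

Lemma triple_mulV g : triple_mul (triple_inv g) g = triple_id (triple_src g).
Proof.
have e := triple_src_inv g.
by apply: triple_eq; rewrite ?(triple_rng_mul, triple_src_mul, triple_lab_mul)//
  ?(triple_src_id, triple_rng_id, triple_lab_id, triple_rng_inv, triple_lab_inv).
Qed.

Lemma triple_mulrV g : triple_mul g (triple_inv g) = triple_id (triple_rng g).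
Proof.
have e := esym (triple_rng_inv g).
by apply: triple_eq; rewrite ?(triple_rng_mul, triple_src_mul, triple_lab_mul)//
  ?(triple_src_id, triple_rng_id, triple_lab_id, triple_src_inv, triple_lab_inv).
Qed.

Definition triple_groupoid : groupoid O T :=
  Groupoid triple_src_id triple_rng_id triple_src_mul triple_rng_mul
    triple_mulA triple_mul1 triple_mulr1 triple_src_inv triple_rng_inv
    triple_mulV triple_mulrV.

End TripleGroupoid.

(** * Ultragraphs *)

Record ultragraph := Ultragraph {
  vertex : countType;
  edge : countType;
  src : edge -> vertex;
  rng : edge -> set vertex;
  rng_neq0 : forall e, rng e !=set0 }.

Section Ultragraph.
Variable G : ultragraph.
Local Notation V := (vertex G).
Local Notation E := (edge G).

Definition generalized_vertex : set (set V) :=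
  smallest
    [set C : set (set V) |
      (forall A B, C A -> C B -> C (A `|` B)) /\
      (forall A B, C A -> C B -> A `&` B !=set0 -> C (A `&` B))]
    (range (fun v : V => [set v]) `|` range (@rng G)).

Definition emitted (A : set V) : set E := [set e | A (src e)].
Definition infinite_emitter (A : set V) : Prop := infinite_set (emitted A).
Definition finite_emitter (A : set V) : Prop := finite_set (emitted A).

Definition sinks : set V := [set v | emitted [set v] = set0].
Definition regular (v : V) : Prop :=
  emitted [set v] !=set0 /\ finite_set (emitted [set v]).

Definition minimal_infinite_emitter (A : set V) : Prop :=
  [/\ generalized_vertex A, infinite_emitter A &
      forall B, generalized_vertex B -> B `<` A ->
        ~ (infinite_emitter B \/ (finite_emitter B /\ infinite_set B))].

Definition minimal_sink (A : set V) : Prop :=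
  [/\ generalized_vertex A, infinite_set A, finite_emitter A &
      forall B, generalized_vertex B -> B `<` A -> ~ infinite_set B].

Definition RFUM2 : Prop := forall e : E,
  exists (k : nat) (A : nat -> set V),
    rng e = \bigcup_(n < k) A n /\
    forall n, (n < k)%N ->
      [\/ minimal_infinite_emitter (A n), minimal_sink (A n) |
          exists2 v, sinks v \/ regular v & A n = [set v]].

(** ** Paths and the boundary space *)

(** [is_path [::]] holds: the empty sequence is the empty word. *)
Definition is_path (a : seq E) : bool :=
  sorted (fun e f => `[< rng e (src f) >]) a.

(** The convention that the empty word has range the set of all vertices makes
    the conditions on ultrapaths and on the sets [pa_dom] below uniform in the
    length of the words. *)
Definition path_rng (a : seq E) : set V :=
  if a is e :: s then rng (last e s) else setT.

(** The ultrapaths of length [0], written (A, A), are encoded as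
    [fin_path [::] A]. *)
Inductive gpath := fin_path of seq E & set V | inf_path of nat -> E.

HB.instance Definition _ := gen_eqMixin gpath.
HB.instance Definition _ := gen_choiceMixin gpath.

Definition is_ultrapath (a : seq E) (A : set V) : Prop :=
  [/\ is_path a, generalized_vertex A & A `<=` path_rng a].

Definition Xsin (a : seq E) (A : set V) : Prop :=
  is_ultrapath a A /\
  (minimal_sink A \/ exists2 v, sinks v & A = [set v]).

Definition Xfin (a : seq E) (A : set V) : Prop :=
  is_ultrapath a A /\
  [\/ minimal_infinite_emitter A, minimal_sink A |
      exists2 v, sinks v & A = [set v]].

Definition boundary_set : set gpath := [set x |
  match x with
  | fin_path a A => Xfin a A
  | inf_path f => forall n, rng (f n) (src (f n.+1))
  end].

Definition boundary : Type := set_type boundary_set.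

HB.instance Definition _ := SubChoice.copy boundary (set_type boundary_set).

Definition len_ge (n : nat) (x : gpath) : Prop :=
  if x is fin_path a _ then (n <= size a)%N else True.

Definition first_edge (x : gpath) : option E :=
  match x with fin_path a _ => ohead a | inf_path f => Some (f 0%N) end.

(** The source of a path of positive length is here the singleton of a vertex,
    so that [s(x) \in B] reads [gpath_src x `<=` B] in all lengths. *)
Definition gpath_src (x : gpath) : set V :=
  match x with
  | fin_path [::] A => A
  | fin_path (e :: _) _ => [set src e]
  | inf_path f => [set src (f 0%N)]
  end.

Definition gpath_cat (a : seq E) (x : gpath) : gpath :=
  match x with
  | fin_path b A => fin_path (a ++ b) A
  | inf_path f => inf_path (fun n => nth (f (n - size a)%N) a n)
  end.

(** ** Topology of the boundary space *)

(** These are the sets D_(b,B) and D_(b,B),F,S; since [gpath_cat b (fin_path [::] C)]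
    is [fin_path b C], the source condition in [cyl] reads C <= B when the tail has
    length [0]. *)
Definition cyl (b : seq E) (B : set V) : set boundary := [set y |
  exists g : boundary, val y = gpath_cat b (val g) /\ gpath_src (val g) `<=` B].

Definition cyl_minus (b : seq E) (B : set V) (F : set E) (S : set V) :
    set boundary :=
  [set y | val y = fin_path b B] `|`
  [set y | exists (g : boundary) (e : E),
     [/\ val y = gpath_cat b (val g), first_edge (val g) = Some e &
         (emitted B `\` F) e]] `|`
  [set y | exists v : V,
     [/\ val y = fin_path b [set v], Xsin b [set v] & (B `\` S) v]].

Definition boundary_base : set (set boundary) :=
  [set U | exists b B, [/\ b != [::], is_ultrapath b B & U = cyl b B]] `|`
  [set U | exists b B F S,
     [/\ Xfin b B, F `<=` emitted B /\ finite_set F,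
         S `<=` B `&` sinks /\ finite_set S & U = cyl_minus b B F S]].


Lemma gpath_cat_cat a b x : gpath_cat (a ++ b) x = gpath_cat a (gpath_cat b x).
Proof.
case: x => [c A|f] /=; first by rewrite catA.
congr inf_path; apply/funext => n; rewrite nth_cat size_cat subnDA.
by case: ltnP => na; [exact: set_nth_default|rewrite (nth_default _ na)].
Qed.

Lemma gpath_cat0 x : gpath_cat [::] x = x.
Proof. by case: x => [//|f] /=; congr inf_path; apply/funext => n; rewrite nth_nil subn0. Qed.

Lemma path_rng_rcons a e : path_rng (rcons a e) = rng e.
Proof. by case: a => [//|e' a] /=; rewrite last_rcons. Qed.

Lemma is_path_rcons a e :
  is_path (rcons a e) <-> is_path a /\ path_rng a (src e).
Proof.
case: a => [//|e' a] /=; rewrite /is_path /= rcons_path.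
by split=> [/andP[-> /asboolP]|[-> /asboolP]].
Qed.

Lemma first_edgeP x e : first_edge x = Some e <->
  exists y, x = gpath_cat [:: e] y.
Proof.
split; last by case=> -[b B|g] ->.
case: x => [[|e' a] A|f] //= [<-].
  by exists (fin_path a A).
exists (inf_path (fun n => f n.+1)) => /=.
by congr inf_path; apply/funext => -[|n] //=; rewrite nth_nil subn1.
Qed.

Lemma gpath_src_cat1 e x : gpath_src (gpath_cat [:: e] x) = [set src e].
Proof. by case: x. Qed.

Lemma boundary_cat1 e x : boundary_set (gpath_cat [:: e] x) <->
  boundary_set x /\ gpath_src x `<=` rng e.
Proof.
case: x => [a A|f] /=; last first.
  split=> [h|[h h0] [|n]] /=.
  - split=> [n|_ ->]; first by have := h n.+1; rewrite /= !nth_nil !subn1.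
    by have /= := h 0%N.
  - exact: h0.
  - by rewrite !nth_nil !subn1; exact: h.
case: a => [|f a] /=.
  by split=> [[[_ gA sA] h]|[[[_ gA sA] h] sA']]; [split|].
rewrite /Xfin /is_ultrapath /is_path /=.
split=> [[[/andP[/asboolP ef pa] gA sA] h]|[[[pa gA sA] h] ef]].
  by split=> // _ ->.
by split=> //; split=> //; apply/andP; split=> //; apply/asboolP/ef.
Qed.

Lemma boundary_cat a x : boundary_set (gpath_cat a x) <->
  [/\ is_path a, boundary_set x & gpath_src x `<=` path_rng a].
Proof.
elim/last_ind: a x => [x|a e IH x]; first by rewrite gpath_cat0; split=> [|[]].
rewrite -cats1 gpath_cat_cat IH gpath_src_cat1 (propext (boundary_cat1 _ _)).
rewrite cats1 (propext (is_path_rcons _ _)) path_rng_rcons.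
split=> [[pa [xb xe] ea]|[[pa ea] xb xe]]; split=> //.
- by split=> //; apply: ea.
- by move=> _ ->.
Qed.

Lemma gpath_cat_inj a : injective (gpath_cat a).
Proof.
move=> [b B|f] [c C|g] //= []; first by move=> /eqP; rewrite eqseq_cat// eqxx /= => /eqP -> ->.
move=> /funeqP h; congr inf_path; apply/funext => n; have := h (size a + n)%N.
by rewrite !nth_default ?leq_addr// addKn.
Qed.

Lemma boundaryP (y : boundary) : boundary_set (val y).
Proof. by case: y => x /= /set_mem. Qed.

Definition to_boundary (x : gpath) (hx : boundary_set x) : boundary :=
  exist (fun x => x \in boundary_set) x (mem_set hx).

Lemma cylP b B y : cyl b B y <->
  exists g, val y = gpath_cat b g /\ gpath_src g `<=` B.
Proof.
split=> [[g h]|[g [yg gB]]]; first by exists (val g).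
have := boundaryP y; rewrite yg => /boundary_cat[_ hg _].
by exists (to_boundary hg).
Qed.

Lemma cyl_minusP b B F S y : cyl_minus b B F S y <->
  [\/ val y = fin_path b B,
      exists g e, val y = gpath_cat (rcons b e) g /\ (emitted B `\` F) e |
      exists v, [/\ val y = fin_path b [set v], Xsin b [set v] & (B `\` S) v]].
Proof.
split=> [[[->|[g [e [yg /first_edgeP[x gx] he]]]]|h]|].
- by apply: Or31.
- by apply: Or32; exists x, e; rewrite yg gx -cats1 gpath_cat_cat.
- exact: Or33.
case=> [h|[g [e [yg he]]]|h]; [by left; left| |by right].
left; right; have := boundaryP y; rewrite yg -cats1 gpath_cat_cat.
move=> /boundary_cat[_ hg _]; exists (to_boundary hg), e; split=> //.
  by rewrite yg -cats1 gpath_cat_cat.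
by apply/first_edgeP; exists g.
Qed.

Lemma boundary_base_inf U y f : boundary_base U -> U y -> val y = inf_path f ->
  exists N, forall n, (N <= n)%N -> cyl (mkseq f n.+1) (rng (f n)) `<=` U.
Proof.
have key b g n : inf_path f = gpath_cat b (inf_path g) -> (size b <= n)%N ->
    exists c, mkseq f n.+1 = b ++ g 0%N :: c.
  move=> /= [-> bn]; exists (mkseq (fun i => g i.+1) (n - size b)).
  have sz : size (b ++ g 0%N :: mkseq (fun i => g i.+1) (n - size b)) = n.+1.
    by rewrite size_cat/= size_mkseq addnS subnKC.
  apply: (@eq_from_nth _ (g 0%N)); rewrite size_mkseq ?sz// => i ilt.
  rewrite nth_mkseq// nth_cat; case: ltnP => ib; first exact: set_nth_default.
  rewrite nth_default//; case E : (i - size b)%N => [//|j] /=.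
  by rewrite nth_mkseq//; lia.
case=> [[b [B [b0 ubB ->]]]|[b [B [F [S [_ _ _ ->]]]]]] + yf.
  rewrite (propext (cylP _ _ _)) yf => -[[c C [//]|g [e gB]]]; exists (size b) => n bn z.
  have [c ->] := key _ _ _ e bn => /cylP[x [zx _]]; apply/cylP.
  exists (gpath_cat (g 0%N :: c) x); split; first by rewrite zx gpath_cat_cat.
  by case: x {zx}.
rewrite (propext (cyl_minusP _ _ _ _ _)) yf.
move=> -[//|[[c C|g] [e [// fE he]]]|[v [] //]].
exists (size b).+1 => n bn z.
have [|c ->] := key _ _ n fE; first by rewrite size_rcons.
move=> /cylP[x [zx _]]; apply/cyl_minusP/Or32.
by exists (gpath_cat (g 0%N :: c) x), e; rewrite zx gpath_cat_cat.
Qed.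

Lemma finite_sub0 T (A : set T) : set0 `<=` A /\ finite_set (@set0 T).
Proof. by split; [exact: sub0set|exact: finite_set0]. Qed.

Lemma boundary_base_fin U y a A : boundary_base U -> U y ->
  val y = fin_path a A -> exists F S,
  [/\ F `<=` emitted A /\ finite_set F, S `<=` A `&` sinks /\ finite_set S &
      cyl_minus a A F S `<=` U].
Proof.
case=> [[b [B [b0 ubB ->]]]|[b [B [F [S [_ hF hS ->]]]]]] + ya.
  rewrite (propext (cylP _ _ _)) ya => -[[c C|g] [// [-> <-] cB]].
  exists set0, set0; split; [exact: finite_sub0|exact: finite_sub0|] => z /cyl_minusP[zA|[g [e [zg [Ae _]]]]|[v [zv _ [Av _]]]];
    apply/cylP.
  - by exists (fin_path c A).
  - exists (gpath_cat (rcons c e) g); rewrite zg rcons_cat gpath_cat_cat.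
    split=> //; case: c cB {ya zg} => [|e' c] cB; last by case: g.
    by case: g => [? ?|?] /= v ->; apply: cB.
  - exists (fin_path c [set v]); split=> //.
    by case: c cB {ya zv} => [|e' c] cB //= w ->; apply: cB.
rewrite (propext (cyl_minusP _ _ _ _ _)) ya.
move=> -[[-> ->]|[[c C|g] [e [// [-> _] he]]]|].
- by exists F, S; split.
- exists set0, set0; split; [exact: finite_sub0|exact: finite_sub0|] => z /cyl_minusP[zA|[g [e' [zg _]]]|[v [zv _ _]]];
    apply/cyl_minusP/Or32.
  + by exists (fin_path c A), e.
  + by exists (gpath_cat (rcons c e') g), e; rewrite zg rcons_cat gpath_cat_cat.
  + by exists (fin_path c [set v]), e.
- move=> [v [[-> ->] sv hv]].
  have nv : ~ exists e, emitted [set v] e.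
    case: sv => _ [[_ iv _ _]|[w sw vw]]; first by case: iv; exact: finite_set1.
    by rewrite vw (sw : emitted _ = _) => -[].
  exists set0, set0; split; [exact: finite_sub0|exact: finite_sub0|] => z.
  move=> /cyl_minusP[zA|[g [e [_ [ve _]]]]|[w [zw _ [wv _]]]].
  - by apply/cyl_minusP/Or33; exists v.
  - by case: nv; exists e.
  - by apply/cyl_minusP/Or33; exists v; split=> //; rewrite zw wv.
Qed.

Lemma cyl_minusS b B F F' S S' : F `<=` F' -> S `<=` S' ->
  cyl_minus b B F' S' `<=` cyl_minus b B F S.
Proof.
move=> FF SS y [[h|[g [e [h1 h2 [h3 h4]]]]]|[v [h1 h2 [h3 h4]]]].
- by left; left.
- by left; right; exists g, e; split=> //; split=> // /FF.
- by right; exists v; split=> //; split=> // /SS.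
Qed.

Lemma boundary_base_cover : \bigcup_(U in boundary_base) U = setT.
Proof.
apply/seteqP; split=> // y _; case E : (val y) => [a A|f].
  exists (cyl_minus a A set0 set0); last by left; left.
  right; exists a, A, set0, set0.
  split; [|exact: finite_sub0|exact: finite_sub0|by []].
  by have := boundaryP y; rewrite E.
have := boundaryP y; rewrite E => yf.
exists (cyl [:: f 0%N] (rng (f 0%N))).
  left; exists [:: f 0%N], (rng (f 0%N)); split=> //; split=> //.
  by apply: sub_gen_smallest; right; exists (f 0%N).
apply/cylP; exists (inf_path (fun n => f n.+1)); split=> /=.
  rewrite E; congr inf_path; apply/funext => -[|n] //=.
  by rewrite nth_nil subn1.
by move=> _ ->; apply: yf.
Qed.

Lemma boundary_base_join U W t : boundary_base U -> boundary_base W ->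
  U t -> W t -> exists B, [/\ boundary_base B, B t & B `<=` U `&` W].
Proof.
move=> bU bW Ut Wt; case E : (val t) => [a A|f].
  have [F [S [[FA fF] [SA fS] FU]]] := boundary_base_fin bU Ut E.
  have [F' [S' [[FA' fF'] [SA' fS'] FW]]] := boundary_base_fin bW Wt E.
  exists (cyl_minus a A (F `|` F') (S `|` S')); split; [|by left; left|].
    right; exists a, A, (F `|` F'), (S `|` S'); split=> //.
    - by have := boundaryP t; rewrite E.
    - by rewrite subUset finite_setU.
    - by rewrite subUset finite_setU.
  move=> y h; split; [apply: FU|apply: FW]; move: y h; apply: cyl_minusS => x xF;
    by [left|right].
have [N hN] := boundary_base_inf bU Ut E.
have [M hM] := boundary_base_inf bW Wt E.
pose n := maxn N M; have := boundaryP t; rewrite E => tf.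
have fE : inf_path f = gpath_cat (mkseq f n.+1) (inf_path (fun i => f (n.+1 + i)%N)).
  congr inf_path; apply/funext => i; rewrite size_mkseq.
  have [il|il] := ltnP i n.+1; first by rewrite nth_mkseq.
  by rewrite nth_default ?size_mkseq// subnKC.
exists (cyl (mkseq f n.+1) (rng (f n))); split.
- left; exists (mkseq f n.+1), (rng (f n)); split=> //.
  have : boundary_set (inf_path f) by [].
  rewrite fE => /boundary_cat[pf _ _]; split=> //.
    by apply: sub_gen_smallest; right; exists (f n).
  by rewrite mkseqS path_rng_rcons.
- apply/cylP; eexists; split; first by rewrite E; exact: fE.
  by move=> _ /= ->; rewrite addn0; apply: tf.
- by move=> y h; split; [apply: hN h|apply: hM h]; rewrite leq_max leqnn ?orbT.
Qed.

HB.instance Definition _ :=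
  @isBaseTopological.Build boundary (set boundary) boundary_base id
    boundary_base_cover boundary_base_join.

Lemma open_boundaryP (U : set boundary) : open U <->
  forall t, U t -> exists B, [/\ boundary_base B, B t & B `<=` U].
Proof.
split=> [[D sD <-] t [B DB Bt]|h].
  exists B; split=> //; first exact: sD.
  by move=> x Bx; exists B.
exists [set B | boundary_base B /\ B `<=` U]; first by move=> B [].
apply/seteqP; split=> [t [B [_ BU] /BU]//|t /h[B [bB Bt BU]]].
by exists B.
Qed.

Lemma boundary_base_open (U : set boundary) : boundary_base U -> open U.
Proof. by move=> bU; apply/open_boundaryP => t Ut; exists U; split. Qed.

Lemma open_cyl_inf (U : set boundary) y f : open U -> U y ->
  val y = inf_path f -> exists N, forall n, (N <= n)%N ->
    cyl (mkseq f n.+1) (rng (f n)) `<=` U.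
Proof.
move=> /open_boundaryP oU /oU[B [bB By BU]] yf.
have [N hN] := boundary_base_inf bB By yf; exists N => n Nn.
exact: subset_trans (hN _ Nn) BU.
Qed.

Lemma open_cyl_fin (U : set boundary) y a A : open U -> U y ->
  val y = fin_path a A -> exists F S,
  [/\ F `<=` emitted A /\ finite_set F, S `<=` A `&` sinks /\ finite_set S &
      cyl_minus a A F S `<=` U].
Proof.
move=> /open_boundaryP oU /oU[B [bB By BU]] ya.
have [F [S [hF hS FB]]] := boundary_base_fin bB By ya; exists F, S; split=> //.
exact: subset_trans FB BU.
Qed.

Lemma inf_path_mkseq f n :
  inf_path f = gpath_cat (mkseq f n) (inf_path (fun i => f (n + i)%N)).
Proof.
congr inf_path; apply/funext => i; rewrite size_mkseq.
have [il|il] := ltnP i n; first by rewrite nth_mkseq.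
by rewrite nth_default ?size_mkseq// subnKC.
Qed.

Lemma boundary_base_cyl f n : boundary_set (inf_path f) ->
  boundary_base (cyl (mkseq f n.+1) (rng (f n))).
Proof.
move=> bf; left; exists (mkseq f n.+1), (rng (f n)); split=> //.
move: (bf); rewrite (inf_path_mkseq f n.+1) => /boundary_cat[pf _ _]; split=> //.
  by apply: sub_gen_smallest; right; exists (f n).
by rewrite mkseqS path_rng_rcons.
Qed.

Lemma cyl_mkseq (y : boundary) f n : val y = inf_path f ->
  cyl (mkseq f n.+1) (rng (f n)) y.
Proof.
move=> yf; apply/cylP; eexists; split; first by rewrite yf; exact: inf_path_mkseq.
by move=> _ /= ->; rewrite addn0; have := boundaryP y; rewrite yf; apply.
Qed.

Lemma boundary_base_cyl_minus (y : boundary) a A F S : val y = fin_path a A ->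
  F `<=` emitted A /\ finite_set F -> S `<=` A `&` sinks /\ finite_set S ->
  boundary_base (cyl_minus a A F S).
Proof.
move=> ya hF hS; right; exists a, A, F, S; split=> //.
by have := boundaryP y; rewrite ya.
Qed.

(** ** The shift *)

(** On paths of length [0], outside the domain of the shift, this is the
    identity. *)
Definition gpath_shift (x : gpath) : gpath :=
  match x with
  | fin_path a A => fin_path (behead a) A
  | inf_path f => inf_path (fun n => f n.+1)
  end.

Lemma gpath_shiftK x : len_ge 1 x ->
  exists e, x = gpath_cat [:: e] (gpath_shift x).
Proof.
case: x => [[//|e a] A _|f _]; first by exists e.
exists (f 0%N); congr inf_path; apply/funext => -[|n] //=.
by rewrite nth_nil subn1.
Qed.

Lemma gpath_cat1K e x : gpath_shift (gpath_cat [:: e] x) = x.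
Proof.
case: x => [//|f] /=; congr inf_path; apply/funext => n.
by rewrite nth_nil subn1.
Qed.

Lemma gpath_shift_boundary x : boundary_set x -> boundary_set (gpath_shift x).
Proof.
case: (pselect (len_ge 1 x)) => [/gpath_shiftK[e {1}->]|].
  by move=> /boundary_cat1[].
by case: x => [[|e a] A|f] // [].
Qed.

Definition shift_map (x : boundary) : boundary :=
  to_boundary (gpath_shift_boundary (boundaryP x)).

Definition shift_dom (n : nat) : set boundary := [set x | len_ge n (val x)].

Lemma gpath_iter_cat a x : iter (size a) gpath_shift (gpath_cat a x) = x.
Proof.
elim: a x => [|e a IH] x; first exact: gpath_cat0.
by rewrite -cat1s gpath_cat_cat iterSr gpath_cat1K IH.
Qed.

Lemma val_iter_shift n x : val (iter n shift_map x) = iter n gpath_shift (val x).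
Proof. by elim: n => //= n <-. Qed.

Lemma iter_shift_fin n a A :
  iter n gpath_shift (fin_path a A) = fin_path (drop n a) A.
Proof. by elim: n => [|n /= ->]; rewrite ?drop0//= -drop1 drop_drop add1n. Qed.

Lemma iter_shift_inf n f :
  exists g, iter n gpath_shift (inf_path f) = inf_path g.
Proof. by elim: n => [|n /= [g ->]]; [exists f|eexists]. Qed.

Lemma len_ge_add m n x :
  len_ge (m + n) x <-> len_ge m x /\ len_ge n (iter m gpath_shift x).
Proof.
case: x => [a A|f]; last by have [g ->] := iter_shift_inf m f.
by rewrite iter_shift_fin /= size_drop; split; [move=> ?; split|case]; lia.
Qed.

Lemma shift_dom_add m n x :
  shift_dom (m + n) x <-> shift_dom m x /\ shift_dom n (iter m shift_map x).
Proof. by rewrite /shift_dom /= val_iter_shift; exact: len_ge_add. Qed.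

Lemma shift_map_cat1 e (x y : boundary) :
  val x = gpath_cat [:: e] (val y) -> shift_map x = y.
Proof. by move=> xy; apply: val_inj; rewrite /= xy gpath_cat1K. Qed.

Lemma open_shift_preimage (W : set boundary) : open W ->
  open (shift_dom 1 `&` shift_map @^-1` W).
Proof.
move=> oW; apply/open_boundaryP => y [y1 Wy].
have [e ye] := gpath_shiftK y1; case E : (gpath_shift (val y)) ye => [a A|f] ye.
  have [F [S [hF hS FW]]] := open_cyl_fin oW Wy E.
  exists (cyl_minus (e :: a) A F S); split; [|by left; left|].
    exact: (boundary_base_cyl_minus ye).
  move=> z /cyl_minusP[za|[g [f [zg hf]]]|[v [zv sv hv]]].
  - split; first by rewrite /shift_dom /= za.
    by apply/FW/cyl_minusP/Or31; rewrite /= za.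
  - split; first by rewrite /shift_dom /= zg; case: {zg} g.
    apply/FW/cyl_minusP/Or32; exists g, f; split=> //.
    by rewrite /= zg rcons_cons -cat1s gpath_cat_cat gpath_cat1K.
  - have shz : val (shift_map z) = fin_path a [set v] by rewrite /= zv.
    split; first by rewrite /shift_dom /= zv.
    apply/FW/cyl_minusP/Or33; exists v; split=> //.
    by have := boundaryP (shift_map z); rewrite shz => -[? _]; split=> //; case: sv.
have [N hN] := open_cyl_inf oW Wy E.
have yE : val y = inf_path (fun i => if i is j.+1 then f j else e).
  rewrite ye; congr inf_path; apply/funext => -[|n] //=.
  by rewrite nth_nil subn1.
have mkE : mkseq (fun i => if i is j.+1 then f j else e) N.+2 = e :: mkseq f N.+1.
  by rewrite /mkseq /= -[2]/(1 + 1)%N (iotaDl 1 1) -map_comp.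
have by_ := boundaryP y; rewrite yE in by_.
exists (cyl (e :: mkseq f N.+1) (rng (f N))); split.
- by rewrite -mkE; exact: (boundary_base_cyl N.+1 by_).
- by rewrite -mkE; exact: (cyl_mkseq N.+1 yE).
move=> z /cylP[g [zg gs]]; split; first by rewrite /shift_dom /= zg; case: {zg gs} g.
apply/(hN N (leqnn _))/cylP; exists g; split=> //.
by rewrite /= zg -cat1s gpath_cat_cat gpath_cat1K.
Qed.

Lemma cyl_minus_src a A F S z :
  cyl_minus a A F S z -> gpath_src (val z) `<=` gpath_src (fin_path a A).
Proof.
case: a => [|e a] /cyl_minusP[->//|[g [f [-> [Af _]]]]|[v [-> _ [Av _]]]] //=.
- by case: g => [? ?|?] w /= ->.
- by move=> w ->.
- by case: g => [? ?|?] w.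
Qed.

Lemma shift_map_image (U : set boundary) e z (h : boundary_set (gpath_cat [:: e] (val z))) :
  U (to_boundary h) -> (shift_map @` U) z.
Proof.
by move=> Uz; exists (to_boundary h) => //; apply: val_inj; rewrite /= gpath_cat1K.
Qed.

Lemma open_shift_image (U : set boundary) : open U -> U `<=` shift_dom 1 ->
  open (shift_map @` U).
Proof.
move=> oU U1; apply/open_boundaryP => t [y Uy yt].
have [e ye] := gpath_shiftK (U1 y Uy).
have {}ye : val y = gpath_cat [:: e] (val t) by rewrite ye -yt.
have ste : gpath_src (val t) `<=` rng e.
  by have := boundaryP y; rewrite ye => /boundary_cat1[].
case E : (val t) => [a A|f].
  have yE : val y = fin_path (e :: a) A by rewrite ye E.
  have [F [S [hF hS FU]]] := open_cyl_fin oU Uy yE.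
  exists (cyl_minus a A F S); split; [|by left; left|].
    exact: (boundary_base_cyl_minus E).
  move=> z zc; have hz : boundary_set (gpath_cat [:: e] (val z)).
    apply/boundary_cat1; split; first exact: boundaryP.
    by rewrite E in ste; exact: subset_trans (cyl_minus_src zc) ste.
  apply: (shift_map_image (h := hz)); apply/FU/cyl_minusP.
  case/cyl_minusP: zc => [za|[g [f [zg hf]]]|[v [zv sv hv]]].
  - by apply: Or31; rewrite /= za.
  - by apply: Or32; exists g, f; split=> //; rewrite /= zg -gpath_cat_cat.
  - apply: Or33; exists v; split=> //; first by rewrite /= zv.
    by move: hz; rewrite zv /= => -[? _]; split=> //; case: sv.
have yE : val y = inf_path (fun i => if i is j.+1 then f j else e).
  rewrite ye E; congr inf_path; apply/funext => -[|n] //=.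
  by rewrite nth_nil subn1.
have [N hN] := open_cyl_inf oU Uy yE.
have mkE : mkseq (fun i => if i is j.+1 then f j else e) N.+2 = e :: mkseq f N.+1.
  by rewrite /mkseq /= -[2]/(1 + 1)%N (iotaDl 1 1) -map_comp.
have bt := boundaryP t; rewrite E in bt.
exists (cyl (mkseq f N.+1) (rng (f N))); split.
- exact: (boundary_base_cyl N bt).
- exact: (cyl_mkseq N E).
move=> z /cylP[g [zg gs]].
have hz : boundary_set (gpath_cat [:: e] (val z)).
  apply/boundary_cat1; split; first exact: boundaryP.
  by rewrite E /= in ste; rewrite zg; case: {zg gs} g.
apply: (shift_map_image (h := hz)); apply/(hN N.+1 (leqnSn _))/cylP.
by exists g; split=> //; rewrite mkE /= zg -gpath_cat_cat.
Qed.

Lemma shift_domS n x : shift_dom n.+1 x <-> shift_dom 1 x /\ shift_dom n (shift_map x).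
Proof. exact: (shift_dom_add 1 n x). Qed.

Lemma shift_dom0 x : shift_dom 0 x.
Proof. by rewrite /shift_dom /=; case: (val x). Qed.

Lemma open_iter_preimage n (W : set boundary) : open W ->
  open (shift_dom n `&` iter n shift_map @^-1` W).
Proof.
move=> oW; elim: n => [|n IH].
  by rewrite (_ : _ `&` _ = W)//; apply/seteqP; split=> [x []//|x Wx]; split=> //; exact: shift_dom0.
rewrite (_ : _ `&` _ = shift_dom 1 `&`
    shift_map @^-1` (shift_dom n `&` iter n shift_map @^-1` W)).
  exact: open_shift_preimage.
apply/seteqP; split=> x.
  by move=> [/shift_domS[? ?]]; rewrite /= -iterS iterSr.
by move=> [x1 [xn xW]]; split; [exact/shift_domS|rewrite /= -iterS iterSr].
Qed.

Lemma open_iter_image n (U : set boundary) : open U -> U `<=` shift_dom n ->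
  open (iter n shift_map @` U).
Proof.
elim: n U => [|n IH] U oU Un; first by rewrite image_id.
rewrite (_ : _ @` _ = iter n shift_map @` (shift_map @` U)).
  apply: IH; last by move=> _ [x Ux <-]; have /shift_domS[] := Un _ Ux.
  by apply: open_shift_image => // x /Un/shift_domS[].
rewrite image_comp; apply/seteqP; split=> _ [x Ux <-]; exists x => //;
  by rewrite /= -iterS iterSr.
Qed.

Lemma open_shift_dom n : open (shift_dom n).
Proof.
have := @open_iter_preimage n setT openT.
by rewrite preimage_setT setIT.
Qed.

Lemma shift_map_local_inj n x : shift_dom n x -> exists U : set boundary,
  [/\ open U, U x, U `<=` shift_dom n & {in U &, injective (iter n shift_map)}].
Proof.
elim: n x => [|n IH] x.
  by exists setT; split=> //; [exact: openT|move=> y _; exact: shift_dom0].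
move=> /shift_domS[x1 /IH[U [oU Ux Un iU]]].
have [e xe] := gpath_shiftK x1.
pose C := [set y : boundary | exists g, val y = gpath_cat [:: e] g].
have oC : open C.
  apply: boundary_base_open; left; exists [:: e], (rng e); split=> //.
    by split=> //; apply: sub_gen_smallest; right; exists e.
  apply/seteqP; split=> y; last by move=> /cylP[g [yg _]]; exists g.
  move=> [g yg]; apply/cylP; exists g; split=> //.
  by have := boundaryP y; rewrite yg => /boundary_cat1[].
exists (C `&` (shift_dom 1 `&` shift_map @^-1` U)); split.
- by apply: openI => //; exact: open_shift_preimage.
- by split=> //; exists (gpath_shift (val x)).
- by move=> y [_ [y1 /Un yn]]; apply/shift_domS.
move=> y z /set_mem[[g yg] [_ Uy]] /set_mem[[h zh] [_ Uz]].
rewrite !iterSr => /(iU _ _ (mem_set Uy) (mem_set Uz)) yz.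
apply: val_inj; rewrite yg zh; congr gpath_cat.
by have := congr1 val yz; rewrite /= yg zh !gpath_cat1K.
Qed.

(** ** The groupoid of the shift *)

(** The partial composites of the shift are [iter n shift_map] on
    [shift_dom n]. *)
Definition dr_set : set (boundary * int * boundary) :=
  [set g | exists m n : nat,
    [/\ shift_dom m g.1.1, shift_dom n g.2, g.1.2 = (m%:Z - n%:Z)%R &
        iter m shift_map g.1.1 = iter n shift_map g.2]].

Definition dr_arrow : Type := set_type dr_set.

HB.instance Definition _ := SubChoice.copy dr_arrow (set_type dr_set).

Lemma dr_set_id x : dr_set (x, 0%R, x).
Proof. by exists 0%N, 0%N; split=> //; rewrite /shift_dom /=; case: (val x). Qed.

Lemma dr_set_mul x k y l z :
  dr_set (x, k, y) -> dr_set (y, l, z) -> dr_set (x, (k + l)%R, z).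
Proof.
move=> [m [n /= [xm yn -> xy]]] [p [q /= [yp zq -> yz]]].
have [np|pn] := leqP n p.
  exists (m + (p - n))%N, q; split=> //=; first 2 last.
  - by rewrite addnC iterD xy -iterD subnK.
  - by apply/shift_dom_add; split=> //; move: yp;
      rewrite xy -{1}(subnKC np) => /shift_dom_add[].
  - lia.
exists m, (q + (n - p))%N; have {}pn := ltnW pn; split=> //=; first 2 last.
- by rewrite xy -{1}(subnK pn) iterD yz -iterD addnC.
- by apply/shift_dom_add; split=> //; move: yn;
    rewrite -yz -{1}(subnKC pn) => /shift_dom_add[].
- lia.
Qed.

Lemma dr_set_inv x k y : dr_set (x, k, y) -> dr_set (y, (- k)%R, x).
Proof.
by move=> [m [n /= [xm yn -> xy]]]; exists n, m; split=> //=; rewrite opprB.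
Qed.

Definition dr_groupoid : groupoid boundary dr_arrow :=
  triple_groupoid (@addrA int) (@add0r int) (@addr0 int) (@addNr int)
    (@addrN int) dr_arrow dr_set_id dr_set_mul dr_set_inv.

(** The set Z(U, m, n, V) *)
Definition dr_cyl (U : set boundary) (m n : nat) (V : set boundary) :
    set dr_arrow :=
  [set g | [/\ U (val g).1.1, (val g).1.2 = (m%:Z - n%:Z)%R, V (val g).2 &
      iter m shift_map (val g).1.1 = iter n shift_map (val g).2]].

Definition dr_base : set (set dr_arrow) := [set W | exists U m n V,
  [/\ open U /\ open V, U `<=` shift_dom m /\ V `<=` shift_dom n,
      {in U &, injective (iter m shift_map)} /\ {in V &, injective (iter n shift_map)},
      iter m shift_map @` U = iter n shift_map @` V & W = dr_cyl U m n V]].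

Lemma drP (g : dr_arrow) : dr_set (val g).
Proof. by case: g => x /= /set_mem. Qed.

Lemma dr_base_restrict (U V : set boundary) m n : open U -> open V ->
  U `<=` shift_dom m -> V `<=` shift_dom n ->
  {in U &, injective (iter m shift_map)} ->
  {in V &, injective (iter n shift_map)} -> dr_base (dr_cyl U m n V).
Proof.
move=> oU oV Um Vn iU iV.
pose W := iter m shift_map @` U `&` iter n shift_map @` V.
have oW : open W by apply: openI; apply: open_iter_image.
pose U' := U `&` (shift_dom m `&` iter m shift_map @^-1` W).
pose V' := V `&` (shift_dom n `&` iter n shift_map @^-1` W).
exists U', m, n, V'; split.
- by split; apply: openI => //; exact: open_iter_preimage.
- by split=> x [_ []].
- split=> x y /set_mem[? _] /set_mem[? _]; [apply: iU|apply: iV]; exact/mem_set.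
- apply/seteqP; split=> _ [x [Ux [xm xW]] <-].
  + have [_ [v Vv ve]] := xW; exists v => //.
    by split=> //; split; [exact: Vn|rewrite /preimage /= ve].
  + have [[u Uu ue] _] := xW; exists u => //.
    by split=> //; split; [exact: Um|rewrite /preimage /= ue].
apply/seteqP; split=> [g [Ug gk Vg ge]|g [[Ug _] gk [Vg _] ge]]; split=> //.
  by split=> //; split; [exact: Um|split; [exists (val g).1.1|exists (val g).2]].
by split=> //; split; [exact: Vn|split; [exists (val g).1.1|exists (val g).2]].
Qed.

Lemma dr_base_cover : \bigcup_(W in dr_base) W = setT.
Proof.
apply/seteqP; split=> // g _; have [m [n [xm yn gk ge]]] := drP g.
have [U [oU Ux Um iU]] := shift_map_local_inj xm.
have [V [oV Vx Vn iV]] := shift_map_local_inj yn.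
by exists (dr_cyl U m n V); [exact: dr_base_restrict|split].
Qed.

Lemma dr_base_join W W' t : dr_base W -> dr_base W' -> W t -> W' t ->
  exists B, [/\ dr_base B, B t & B `<=` W `&` W'].
Proof.
have main (U V U' V' : set boundary) m n j : open U -> open V -> open U' -> open V' ->
    U `<=` shift_dom m -> V `<=` shift_dom n ->
    U' `<=` shift_dom (m + j) -> V' `<=` shift_dom (n + j) ->
    {in U &, injective (iter m shift_map)} ->
    {in V &, injective (iter n shift_map)} ->
    dr_cyl U m n V t -> dr_cyl U' (m + j) (n + j) V' t ->
    exists B, [/\ dr_base B, B t &
      B `<=` dr_cyl U m n V `&` dr_cyl U' (m + j) (n + j) V'].
  move=> oU oV oU' oV' Um Vn Um' Vn' iU iV [Ut kt Vt et] [Ut' kt' Vt' et'].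
  exists (dr_cyl (U `&` U') m n (V `&` V')); split.
  - apply: dr_base_restrict; [exact: openI|exact: openI| | | |].
    + by move=> x [/Um].
    + by move=> x [/Vn].
    + by move=> x y /set_mem[? _] /set_mem[? _]; apply: iU; exact/mem_set.
    + by move=> x y /set_mem[? _] /set_mem[? _]; apply: iV; exact/mem_set.
  - by split.
  move=> g [[Ug Ug'] gk [Vg Vg'] ge]; split; split=> //; first lia.
  by rewrite addnC iterD ge -iterD addnC.
move=> [U [m [n [V [[oU oV] [Um Vn] [iU iV] _ ->]]]]].
move=> [U' [m' [n' [V' [[oU' oV'] [Um' Vn'] [iU' iV'] _ ->]]]]] ht ht'.
have [_ kt _ _] := ht; have [_ kt' _ _] := ht'.
have [mm|/ltnW mm] := leqP m m'.
  have mE : m' = (m + (m' - m))%N by lia.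
  have nE : n' = (n + (m' - m))%N by lia.
  move: (m' - m)%N mE nE => j ? ?; subst m' n'.
  exact: main.
have mE : m = (m' + (m - m'))%N by lia.
have nE : n = (n' + (m - m'))%N by lia.
move: (m - m')%N mE nE => j ? ?; subst m n.
rewrite setIC; exact: main.
Qed.

HB.instance Definition _ :=
  @isBaseTopological.Build dr_arrow (set dr_arrow) dr_base id
    dr_base_cover dr_base_join.

(** ** The partial action of the free group and its groupoid *)

(** This is X_c: with [path_rng [::] = setT], the word [c = a b^-1] with [a] or
    [b] empty yields X_0 = X, X_a and X_(b^-1); [pa_dom c] is empty when [c] is
    not of this form. *)
Definition pa_dom (c : free_group E) : set boundary :=
  [set x | exists a b (z : boundary),
    [/\ is_path a /\ is_path b, reduced_form c a b,
        val x = gpath_cat a (val z) &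
        gpath_src (val z) `<=` path_rng a `&` path_rng b]].

(** [theta c] is the partial map [bz |-> az] for [c = a b^-1] reduced; it is
    irrelevant outside [pa_dom c^-1]. *)
Definition theta (c : free_group E) (y : boundary) : boundary :=
  xget y [set x | exists a b (z : boundary),
    [/\ reduced_form c a b, val y = gpath_cat b (val z) &
        val x = gpath_cat a (val z)]].

Definition trans_set : set (boundary * free_group E * boundary) :=
  [set g | pa_dom (g.1.2^-1)%g g.2 /\ g.1.1 = theta g.1.2 g.2].

Lemma gpath_cat_eq a b x y : gpath_cat a x = gpath_cat b y ->
  (size a <= size b)%N -> exists c, b = a ++ c /\ x = gpath_cat c y.
Proof.
elim: a b x y => [|e a IH] b x y; first by rewrite gpath_cat0; exists b.
case: b => [//|f b]; rewrite -cat1s -(cat1s f) !gpath_cat_cat => h ab.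
have ef : e = f.
  suff : Some e = Some f by case.
  rewrite -((first_edgeP (gpath_cat [:: e] (gpath_cat a x)) e).2); last by eexists.
  by rewrite h; apply/first_edgeP; eexists.
move: h; rewrite ef => /gpath_cat_inj/IH/(_ ab)[c [-> ->]].
by exists c.
Qed.

Lemma trans_setP x c y : trans_set (x, c, y) <->
  exists a b z, [/\ c = (fg_positive a * (fg_positive b)^-1)%g,
    val x = gpath_cat a z & val y = gpath_cat b z].
Proof.
have red x' a b z : reduced_form c a b -> val x' = gpath_cat a z ->
    val y = gpath_cat b z -> trans_set (x', c, y).
  move=> cab xa yb; have := boundaryP x'; rewrite xa => /boundary_cat[pa hz za].
  have := boundaryP y; rewrite yb => /boundary_cat[pb _ zb]; split=> /=.
    exists b, a, (to_boundary hz); split=> //; first exact: reduced_form_inv.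
    by move=> v zv; split; [exact: zb|exact: za].
  apply/esym/xget_unique; first by exists a, b, (to_boundary hz).
  move=> x'' [a' [b' [z' [cab' yb' xa']]]].
  have [? ?] := reduced_form_inj cab cab'; subst a' b'; apply: val_inj.
  by rewrite xa xa'; congr gpath_cat; apply: (@gpath_cat_inj b); rewrite -yb' yb.
split=> [[/= [b [a [z [[_ pa] cba yb za]]]] xE]|[a [b [z [cE xa yb]]]]].
  have {}cba := reduced_form_inv cba; rewrite invgK in cba.
  have hx : boundary_set (gpath_cat a (val z)).
    apply/boundary_cat; split=> //; first exact: boundaryP.
    by move=> v /za[].
  have [_ /= thE] := red (to_boundary hx) a b (val z) cba erefl yb.
  by exists a, b, (val z); rewrite {1}(reduced_formE cba) xE -thE.
elim/last_ind: a b z cE xa yb => [|a e IH] b z cE xa yb.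
  by apply: (@red x [::] b z) => //; rewrite cE; apply: reduced_formP; left.
case/lastP: b cE yb => [|b f] cE yb.
  apply: (@red x (rcons a e) [::] z) => //; rewrite cE.
  by apply: reduced_formP; right; left.
have [ef|ef] := eqVneq e f; last first.
  apply: (@red x (rcons a e) (rcons b f) z) => //; rewrite cE.
  by apply: reduced_formP; right; right; exists a, e, b, f.
apply: (IH b (gpath_cat [:: e] z)); last first.
- by rewrite yb -cats1 gpath_cat_cat ef.
- by rewrite xa -cats1 gpath_cat_cat.
- by rewrite cE -!cats1 !fg_positive_cat ef invgM mulgA mulgK.
Qed.

Lemma trans_set_id x : trans_set (x, 1%g, x).
Proof.
apply/trans_setP; exists [::], [::], (val x).
by rewrite mulgV gpath_cat0.
Qed.

Lemma trans_set_inv x c y : trans_set (x, c, y) -> trans_set (y, (c^-1)%g, x).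
Proof.
move=> /trans_setP[a [b [z [-> xa yb]]]]; apply/trans_setP; exists b, a, z.
by rewrite invgM invgK.
Qed.

Lemma trans_set_mul x c y d z :
  trans_set (x, c, y) -> trans_set (y, d, z) -> trans_set (x, (c * d)%g, z).
Proof.
move=> /trans_setP[a [b [u [-> xa yb]]]] /trans_setP[a' [b' [w [-> ya zb]]]].
apply/trans_setP; move: ya; rewrite yb => h.
have [ba|/ltnW ba] := leqP (size b) (size a').
  have [t [a't ut]] := gpath_cat_eq h ba; exists (a ++ t), b', w; split=> //.
    by rewrite a't !fg_positive_cat -!mulgA; congr (_ * _)%g; rewrite mulgA mulgA mulVg mul1g.
  by rewrite xa ut gpath_cat_cat.
have [t [bt wt]] := gpath_cat_eq (esym h) ba; exists a, (b' ++ t), u; split=> //.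
  by rewrite bt !fg_positive_cat !invgM -!mulgA; congr (_ * (_ * _))%g; rewrite mulgA mulVg mul1g.
by rewrite zb wt gpath_cat_cat.
Qed.

Definition trans_arrow : topologicalType := set_type trans_set.

Definition trans_groupoid : groupoid boundary trans_arrow :=
  triple_groupoid (@mulgA (free_group E)) (@mul1g (free_group E))
    (@mulg1 (free_group E)) (@mulVg (free_group E)) (@mulgV (free_group E))
    (set_type trans_set) trans_set_id trans_set_mul trans_set_inv.

End Ultragraph.

(* Main.v *)
Require Import Defs.
From mathcomp Require Import all_boot all_order all_algebra.
From mathcomp Require Import all_classical all_reals all_analysis.
From mathcomp Require Import zify.

(** The map (x, a b^-1, y) |-> (x, |a| - |b|, y) only replaces a label in the
    free group by its image under the homomorphism [degree] that sends every
    edge to 1, so it is multiplicative. The whole content is that the two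
    groupoids have the same arrows and the same topology.

    Both groupoids say that x and y share a tail, x = a u and y = b u, and
    differ in what they remember of the pair (a, b). No information is lost in
    passing to the length difference: for two decompositions x = a u = a' v and
    y = b u = b' v with |a| - |b| = |a'| - |b'| and, say, |a| <= |a'|, one has
    a' = a t and u = t v, and then b' = b t by comparing lengths in y; hence
    a b^-1 = a' b'^-1 in the free group ([trans_set_fibre]). This gives
    injectivity, also when x and y are periodic infinite paths. For
    surjectivity, an equality sigma^m x = sigma^n y exhibits a common tail, with
    a and b the prefixes of lengths m and n ([dr_set_word]).

    For continuity, let (x, c, y) be mapped into Z(U, m, n, V). By injectivity
    c = a b^-1 with |a| = m and |b| = n, so the reduced form of c arises from
    (a, b) by removing a common suffix. Any other arrow with the same label c
    therefore satisfies sigma^m x' = sigma^n y' too ([trans_set_iter_shift]),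
    and the preimage of Z(U, m, n, V) contains every arrow over U x {c} x V. For
    openness, let c have the reduced form a b^-1. An arrow in
    Z(U, |a|, |b|, V) whose ends begin with a and b respectively has a common
    tail behind a and b, so it is the image of an arrow labelled c; beginning
    with a given path is an open condition on which the corresponding power of
    the shift is injective ([open_starts_with], [starts_with_inj]). *)

(** * The degree homomorphism and reduced forms in the free group *)

Section Degree.
Import GRing.Theory.
Local Open Scope ring_scope.
Set Implicit Arguments.
Unset Strict Implicit.
Variable E : choiceType.

Definition letter_degree (l : E * bool) : int := if l.2 then 1 else -1.

Definition degree (c : free_group E) : int :=
  \sum_(l <- fg_word c) letter_degree l.

Lemma degreeM c d : degree (c * d)%g = degree c + degree d.
Proof.
rewrite /degree /=; elim: (fg_word c) => [|l u IH] /=.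
  by rewrite big_nil add0r.
rewrite big_cons -addrA -IH; case: (fg_cat u _) => [|l' w] /=.
  by rewrite big_cons big_nil.
case: eqP => [->|_]; last by rewrite big_cons.
rewrite big_cons addrA /letter_degree /letter_inv /=.
by case: l.2; rewrite /= ?subrr ?addNr add0r.
Qed.

Lemma degree_fraction (a b : seq E) :
  degree (fg_positive a * (fg_positive b)^-1)%g = (size a)%:Z - (size b)%:Z.
Proof.
have pos s : degree (fg_positive s) = (size s)%:Z.
  rewrite /degree /=; elim: s => [|e s IH]; first by rewrite big_nil.
  by rewrite big_cons IH /= -addn1 addnC PoszD.
have inv : degree (fg_positive b)^-1%g = - degree (fg_positive b).
  by apply: (addrI (degree (fg_positive b)));
    rewrite -degreeM mulgV subrr /degree big_nil.
by rewrite degreeM inv !pos.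
Qed.

Lemma reduced_form_degree (c : free_group E) a b :
  reduced_form c a b -> degree c = (size a)%:Z - (size b)%:Z.
Proof. by move=> /reduced_formE ->; exact: degree_fraction. Qed.

Lemma fraction_cancel_suffix (a b t : seq E) :
  (fg_positive (a ++ t) * (fg_positive (b ++ t))^-1 =
   fg_positive a * (fg_positive b)^-1)%g.
Proof. by rewrite !fg_positive_cat invgM mulgA mulgK. Qed.

(** The only cancellation in a b^-1 is between equal last letters of a and b. *)
Lemma fraction_reduced_form (a b : seq E) : exists a0 b0 t,
  [/\ a = a0 ++ t, b = b0 ++ t &
      reduced_form (fg_positive a * (fg_positive b)^-1)%g a0 b0].
Proof.
elim/last_ind: a b => [|a e IH] b.
  by exists [::], b, [::]; rewrite !cats0; split=> //; apply: reduced_formP; left.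
case/lastP: b => [|b f].
  exists (rcons a e), [::], [::]; rewrite !cats0; split=> //.
  by apply: reduced_formP; right; left.
have [<-|ef] := eqVneq e f; last first.
  exists (rcons a e), (rcons b f), [::]; rewrite !cats0; split=> //.
  by apply: reduced_formP; right; right; exists a, e, b, f.
have [a0 [b0 [t [aE bE red]]]] := IH b.
exists a0, b0, (rcons t e); rewrite -!rcons_cat -aE -bE; split=> //.
by rewrite -!cats1 fraction_cancel_suffix.
Qed.

End Degree.

Section Isomorphism.
Import Order.TTheory GRing.Theory Num.Theory.
Local Open Scope classical_set_scope.
Set Implicit Arguments.
Unset Strict Implicit.
Variable G : ultragraph.
Implicit Types (x y z : boundary G) (a b : seq (edge G)) (c d : free_group (edge G)).

(** * Common tails: arrows of the two groupoids *)

Lemma gpath_cat_prefix a b (u v : gpath G) : gpath_cat a u = gpath_cat b v ->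
  size a = size b -> a = b.
Proof.
move=> uv ab; have [t [bE _]] := gpath_cat_eq uv (eq_leq ab).
move: ab; rewrite bE size_cat => /eqP; rewrite -[X in X == _]addn0 eqn_add2l eq_sym.
by move=> /nilP ->; rewrite cats0.
Qed.

Lemma shift_dom_cat a x (u : gpath G) : val x = gpath_cat a u -> shift_dom (size a) x.
Proof. by rewrite /shift_dom /= => ->; case: u => //= b B; rewrite size_cat leq_addr. Qed.

Lemma val_iter_shift_cat a x (u : gpath G) : val x = gpath_cat a u ->
  val (iter (size a) (@shift_map G) x) = u.
Proof. by move=> xa; rewrite val_iter_shift xa gpath_iter_cat. Qed.

Lemma shift_dom_prefix n x : shift_dom n x -> exists2 a, size a = n &
  val x = gpath_cat a (val (iter n (@shift_map G) x)).
Proof.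
elim: n x => [|n IH] x; first by exists [::] => //; rewrite gpath_cat0.
move=> /shift_domS[x1 /IH[a an xa]]; have [e xe] := gpath_shiftK x1.
exists (e :: a); first by rewrite /= an.
by rewrite iterSr -cat1s gpath_cat_cat -xa.
Qed.

(** A description of arrows by a word in reduced form, where [trans_setP] allows
    an arbitrary one; uniqueness of reduced forms then makes (a, b) depend on
    the label only. *)
Lemma trans_set_reduced x c y : trans_set (x, c, y) -> exists a b z,
  [/\ is_path a /\ is_path b, reduced_form c a b,
      val x = gpath_cat a (val z) & val y = gpath_cat b (val z)].
Proof.
move=> /trans_setP[a [b [u [-> xa yb]]]].
have [a0 [b0 [t [aE bE red]]]] := fraction_reduced_form a b.
rewrite aE gpath_cat_cat in xa; rewrite bE gpath_cat_cat in yb.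
have := boundaryP x; rewrite xa => /boundary_cat[pa hz _].
have := boundaryP y; rewrite yb => /boundary_cat[pb _ _].
by exists a0, b0, (to_boundary hz).
Qed.

(** Between two given points, the longer decomposition extends the shorter one
    by the same word on both sides, and that word cancels in the free group. *)
Lemma trans_set_fibre x c d y : trans_set (x, c, y) -> trans_set (x, d, y) ->
  degree c = degree d -> c = d.
Proof.
move=> /trans_setP[a [b [u [-> xa yb]]]] /trans_setP[a' [b' [v [-> xa' yb']]]].
rewrite !degree_fraction.
wlog le_aa' : a b a' b' u v xa yb xa' yb' / (size a <= size a')%N.
  move=> H dd; have [aa'|/ltnW a'a] := leqP (size a) (size a').
    exact: H xa yb xa' yb' aa' dd.
  exact/esym/(H _ _ _ _ _ _ xa' yb' xa yb a'a)/esym.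
move=> dd; rewrite xa in xa'; have [t [aE uE]] := gpath_cat_eq xa' le_aa'.
have <- : b ++ t = b'.
  apply: (@gpath_cat_prefix _ _ v v); first by rewrite gpath_cat_cat -uE -yb -yb'.
  move: dd; rewrite aE !size_cat.
  by move: (size a) (size b) (size t) (size b') => p q r s; lia.
by rewrite aE fraction_cancel_suffix.
Qed.

Lemma trans_set_dr_set x c y : trans_set (x, c, y) -> dr_set (x, degree c, y).
Proof.
move=> /trans_setP[a [b [u [-> xa yb]]]]; exists (size a), (size b); split=> /=.
- exact: shift_dom_cat xa.
- exact: shift_dom_cat yb.
- exact: degree_fraction.
- by apply: val_inj; rewrite (val_iter_shift_cat xa) (val_iter_shift_cat yb).
Qed.

(** Every arrow of the shift groupoid lifts, with prescribed lengths: a and b are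
    the parts of x and y that the shifts delete. *)
Lemma dr_set_word m n x y : shift_dom m x -> shift_dom n y ->
  iter m (@shift_map G) x = iter n (@shift_map G) y ->
  exists a b, [/\ size a = m, size b = n &
    trans_set (x, (fg_positive a * (fg_positive b)^-1)%g, y)].
Proof.
move=> /shift_dom_prefix[a am xa] /shift_dom_prefix[b bn yb] xy.
exists a, b; split=> //; apply/trans_setP.
by exists a, b, (val (iter m (@shift_map G) x)); split=> //; rewrite xy.
Qed.

(** The reason for continuity: whether sigma^m x = sigma^n y holds is decided by
    the label alone, because m and n exceed the lengths in its reduced form by
    the same amount, the length of the cancelled suffix. *)
Lemma trans_set_iter_shift m n x y x' y' c : trans_set (x, c, y) ->
  degree c = (m%:Z - n%:Z)%R -> shift_dom m x -> shift_dom n y ->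
  iter m (@shift_map G) x = iter n (@shift_map G) y -> trans_set (x', c, y') ->
  iter m (@shift_map G) x' = iter n (@shift_map G) y'.
Proof.
move=> xcy cmn xm yn xy x'cy'.
have [a [b [am bn xaby]]] := dr_set_word xm yn xy.
have cE : c = (fg_positive a * (fg_positive b)^-1)%g.
  by apply: trans_set_fibre xcy xaby _; rewrite degree_fraction cmn am bn.
have [a0 [b0 [t [aE bE red]]]] := fraction_reduced_form a b; rewrite -cE in red.
have [a1 [b1 [z [_ red' x'a y'b]]]] := trans_set_reduced x'cy'.
have [? ?] := reduced_form_inj red red'; subst a1 b1.
rewrite -am -bn aE bE !size_cat ![(size _ + size t)%N]addnC !iterD; congr iter.
by apply: val_inj; rewrite (val_iter_shift_cat x'a) (val_iter_shift_cat y'b).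
Qed.

Definition starts_with a : set (boundary G) :=
  [set x | exists u, val x = gpath_cat a u].

(** For nonempty a this is the basic open set D_(a, r(a)). *)
Lemma open_starts_with a : is_path a -> open (starts_with a).
Proof.
move=> pa; case/lastP: a pa => [|a e] pa.
  rewrite (_ : starts_with _ = setT); first exact: openT.
  by apply/seteqP; split=> // x _; exists (val x); rewrite gpath_cat0.
apply: boundary_base_open; left; exists (rcons a e), (rng e); split.
- by case: (a).
- split=> //; last by rewrite path_rng_rcons.
  by apply: sub_gen_smallest; right; exists e.
apply/seteqP; split=> x; last by move=> /cylP[u [xu _]]; exists u.
move=> [u xu]; apply/cylP; exists u; split=> //.
by have := boundaryP x; rewrite xu => /boundary_cat[_ _]; rewrite path_rng_rcons.
Qed.

Lemma starts_with_shift a x : starts_with a x ->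
  val x = gpath_cat a (val (iter (size a) (@shift_map G) x)).
Proof. by move=> [u xu]; rewrite (val_iter_shift_cat xu). Qed.

Lemma starts_with_inj a : {in starts_with a &, injective (iter (size a) (@shift_map G))}.
Proof.
move=> x y /set_mem/starts_with_shift xa /set_mem/starts_with_shift ya xy.
by apply: val_inj; rewrite xa ya xy.
Qed.

Lemma transP (g : trans_arrow G) :
  trans_set (triple_rng g, triple_lab g, triple_src g).
Proof. exact: tripleP. Qed.

(** * The topologies of the two groupoids *)

(** As the free group is discrete, the label can be kept fixed locally. *)
Lemma open_trans_arrowP (W : set (trans_arrow G)) : open W <->
  forall g, W g -> exists A B : set (boundary G),
    [/\ open A /\ open B, A (triple_rng g), B (triple_src g) &
        forall h, triple_lab h = triple_lab g -> A (triple_rng h) ->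
          B (triple_src h) -> W h].
Proof.
split=> [[Q oQ <-] g Qg|loc].
  have : nbhs (val g) Q by apply: open_nbhs_nbhs.
  move=> [[P B] /= [[[A C] /= [Ag Cg] ACP] Bg] PBQ].
  exists A°, B°; split.
  - by split; exact: open_interior.
  - exact: Ag.
  - exact: Bg.
  move=> h hg Ah Bh; rewrite /preimage /=.
  rewrite [set_val h](surjective_pairing (val h)); apply: PBQ; split=> /=.
    rewrite [(val h).1]surjective_pairing; apply: ACP; split=> /=.
      exact: interior_subset Ah.
    rewrite [(val h).1.2]hg; exact: nbhs_singleton.
  exact: interior_subset Bh.
rewrite openE => g /loc[A [B [[oA oB] Ag Bg ABW]]].
have nA : nbhs (triple_rng g) A by exact: open_nbhs_nbhs.
have nB : nbhs (triple_src g) B by exact: open_nbhs_nbhs.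
apply: (@filterS _ _ _ (val @^-1` [set p | [/\ A p.1.1, p.1.2 = triple_lab g & B p.2]])).
  by move=> h [Ah hg Bh]; exact: ABW.
apply: (@initial_continuous _ _ val g).
exists ([set q | A q.1 /\ q.2 = triple_lab g], B); last by move=> p [/= [Ap pc] Bp].
split=> //=; exists (A, [set triple_lab g]); last by move=> q [].
by split=> //=; exact: discrete_set1.
Qed.

Lemma open_dr_arrowP (W : set (dr_arrow G)) : open W <->
  forall g, W g -> exists B, [/\ dr_base B, B g & B `<=` W].
Proof.
split=> [[D sD <-] t [B DB Bt]|h].
  exists B; split=> //; first exact: sD.
  by move=> u Bu; exists B.
exists [set B | dr_base B /\ B `<=` W]; first by move=> B [].
apply/seteqP; split=> [t [B [_ BW] /BW]//|t /h[B [bB Bt BW]]].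
by exists B.
Qed.

(** * The isomorphism *)

Definition Psi (g : trans_arrow G) : dr_arrow G :=
  exist (fun t => t \in @dr_set G)
    (triple_rng g, degree (triple_lab g), triple_src g)
    (mem_set (trans_set_dr_set (transP g))).

Lemma Psi_inj : injective Psi.
Proof.
move=> g h /(congr1 val)[xx cc yy]; apply: triple_eq => //.
by apply: trans_set_fibre cc; [exact: transP|rewrite xx yy; exact: transP].
Qed.

Lemma Psi_surj h : exists g, Psi g = h.
Proof.
have [m [n [xm yn k xy]]] := drP h.
have [a [b [am bn xaby]]] := dr_set_word xm yn xy.
exists (exist (fun t => t \in @trans_set G) _ (mem_set xaby)); apply: val_inj.
rewrite /= /triple_lab /= degree_fraction am bn -k /triple_rng /triple_src /=.
by rewrite -!surjective_pairing.
Qed.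

Lemma Psi_bij : bijective Psi.
Proof.
have [Phi PhiK] := choice Psi_surj.
by exists Phi => // g; apply: Psi_inj; rewrite PhiK.
Qed.

Lemma Psi_continuous : continuous Psi.
Proof.
apply/continuousP => W /open_dr_arrowP oW; apply/open_trans_arrowP => g /oW.
move=> [_ [[U [m [n [V [[oU oV] [Um Vn] _ _ ->]]]]] [Ug k Vg xy] UVW]].
exists U, V; split=> // h hg Uh Vh; apply: UVW; split=> //=; first by rewrite hg.
exact: trans_set_iter_shift (transP g) k (Um _ Ug) (Vn _ Vg) xy
  (eq_rect _ (fun c => trans_set (_, c, _)) (transP h) _ hg).
Qed.

Lemma Psi_open (W : set (trans_arrow G)) : open W -> open (Psi @` W).
Proof.
move=> /open_trans_arrowP oW; apply/open_dr_arrowP => _ [g /oW[A [B [[oA oB] Ag Bg ABW]]] <-].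
have [a [b [z [[pa pb] red xa yb]]]] := trans_set_reduced (transP g).
have ga : starts_with a (triple_rng g) by exists (val z).
have gb : starts_with b (triple_src g) by exists (val z).
exists (dr_cyl (A `&` starts_with a) (size a) (size b) (B `&` starts_with b)).
split.
- apply: dr_base_restrict.
  + by apply: openI => //; exact: open_starts_with.
  + by apply: openI => //; exact: open_starts_with.
  + by move=> x [_ [u xu]]; exact: shift_dom_cat xu.
  + by move=> x [_ [u xu]]; exact: shift_dom_cat xu.
  + by move=> x y /set_mem[_ xs] /set_mem[_ ys]; apply: starts_with_inj; exact/mem_set.
  + by move=> x y /set_mem[_ xs] /set_mem[_ ys]; apply: starts_with_inj; exact/mem_set.
- split=> //=; first exact: reduced_form_degree.
  by apply: val_inj; rewrite (val_iter_shift_cat xa) (val_iter_shift_cat yb).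
move=> k [[Ak ka] kE [Bk kb] xy].
have hk : trans_set ((val k).1.1, triple_lab g, (val k).2).
  apply/trans_setP; exists a, b, (val (iter (size a) (@shift_map G) (val k).1.1)).
  split; [exact: reduced_formE|exact: starts_with_shift|].
  by rewrite xy; exact: starts_with_shift.
exists (exist (fun t => t \in @trans_set G) _ (mem_set hk)); first exact: ABW.
apply: val_inj; rewrite /= /triple_lab /= -/(triple_lab g) (reduced_form_degree red) -kE.
by rewrite /triple_rng /triple_src /= -!surjective_pairing.
Qed.

End Isomorphism.

Theorem theorem5p12 (G : ultragraph) (hG : RFUM2 G) :
  exists Psi : trans_arrow G -> dr_arrow G,
    (forall (g : trans_arrow G) (x y : boundary G) (c : free_group (edge G)),
      val g = (x, c, y) ->
      exists (a b : seq (edge G)) (x' : boundary G),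
        [/\ is_path a /\ is_path b,
            reduced_form c a b,
            val x = gpath_cat a (val x'),
            val y = gpath_cat b (val x') &
            val (Psi g) = (x, ((size a)%:Z - (size b)%:Z)%R, y)]) /\
    topological_groupoid_isomorphism (trans_groupoid G) (dr_groupoid G) Psi.
Proof.
exists (@Psi G); split.
  move=> g x y c gE; have := transP g.
  rewrite /triple_rng /triple_lab /triple_src gE => /trans_set_reduced.
  move=> [a [b [z [pab red xa yb]]]]; exists a, b, z; split=> //.
  by rewrite /= /triple_rng /triple_lab /triple_src gE (reduced_form_degree red).
split; last by split; [exact: Psi_bij|exact: Psi_continuous|exact: Psi_open].
split=> [|//|g h gh]; first exact: Psi_bij.
have gh' : triple_src (Psi g) = triple_rng (Psi h) by [].
apply: val_inj; rewrite [RHS](val_triple_mul (@dr_set_mul G) gh') /=.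
have S_mul := @trans_set_mul G; have {}gh : triple_src g = triple_rng h by [].
by rewrite (triple_rng_mul S_mul gh) (triple_lab_mul S_mul gh)
  (triple_src_mul S_mul gh) degreeM.
Qed.
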